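(* Let $n$ be a composite integer and let $\ell$ be the smallest prime factor of $n$. Then $C_q(n)=0$ if and only if $(q,n)=(2,9)$. If $(q,n)\neq(2,9)$, then $C_q(n)=1$ if and only if $(q,n)=(2,4)$, and moreover $$C_q(n)\ge \frac{q^n}{(2n)^{\ell}}.$$
   Context: $\mathbb{F}_q$ is the finite field with $q$ elements. A finite ring $S$ is a Carmichael ring if $S$ is not a field and $a^{|S|}=a$ for every $a\in S$. A polynomial $f\in\mathbb{F}_q[t]$ is a Carmichael polynomial if $\mathbb{F}_q[t]/(f)$ is a Carmichael ring. $C_q(n)$ denotes the number of monic Carmichael polynomials in $\mathbb{F}_q[t]$ of degree $n$. *)

(* Defs.v *)
From HB Require Import structures.
From mathcomp Require Import all_boot all_order all_algebra all_field.
Set Implicit Arguments. Unset Strict Implicit. Unset Printing Implicit Defensive.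
Import GRing.Theory.
Local Open Scope ring_scope.

(* A finite (commutative unit) ring S is a field iff every nonzero element
   is a unit (S is nontrivial by its nzRing structure). *)
Definition is_fieldb (S : finComUnitRingType) : bool :=
  [forall a : S, (a != 0) ==> (a \is a GRing.unit)].

Definition carmichael_ring (S : finComUnitRingType) : bool :=
  ~~ is_fieldb S && [forall a : S, a ^+ #|S| == a].

(* f is a Carmichael polynomial: F[t]/(f) is a Carmichael ring.
   ({poly %/ f} is the quotient ring F[t]/(f) for monic f of size > 1.) *)
Definition carmichael_poly (F : finFieldType) (f : {poly F}) : bool :=
  carmichael_ring [the finComUnitRingType of {poly %/ f}].

Definition Cq (F : finFieldType) (n : nat) : nat :=
  #|[set p : {poly_(n.+1) F} |
      [&& polyn p \is monic, size (polyn p) == n.+1 & carmichael_poly (polyn p)]]|.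

(* Main.v *)
(* A monic f of degree n is Carmichael iff it is reducible and divides
   X^(q^n) - X; that is, iff f is a product of distinct monic irreducibles
   whose degrees are proper divisors of n.  Write n = l * m and let N be the
   number of monic irreducibles of degree m.  Products of l of them give
   C_q(n) >= binomial(N, l) >= (N / l)^l when N >= l.  Since X^(q^m) - X is
   squarefree, q^m <= m N + sum_{d | m, d < m} q^d, hence q^m <= 2 m N.
   This yields N > l unless q = 2 and n is 4, 6 or 9.  For n = p^2 every
   Carmichael polynomial divides X^(q^p) - X, which settles 4 and 9; for
   n = 6 there is the additional factorization type 1 + 2 + 3. *)
Require Import Defs.
From mathcomp Require Import all_boot all_order all_algebra all_field.
From mathcomp Require Import zify.
Set Implicit Arguments. Unset Strict Implicit. Unset Printing Implicit Defensive.
Import GRing.Theory.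
Local Open Scope ring_scope.

(** * The polynomials X^(q^k) - X and their divisors *)

Section Frobenius.
Variable F : finFieldType.
Implicit Types (f g h p : {poly F}) (k m : nat).

(** For k > 0 its roots in an algebraic closure form the field with q^k elements. For k = 0 it is
    zero, so every polynomial divides it. *)
Definition frobX k : {poly F} := 'X^(#|F| ^ k) - 'X.

Lemma card_gt1 : (1 < #|F|)%N.
Proof. exact: finNzRing_gt1. Qed.

Lemma expn_card_gt1 k : (0 < k)%N -> (1 < #|F| ^ k)%N.
Proof. by move=> k_gt0; rewrite -[1%N](exp1n k) ltn_exp2r ?card_gt1. Qed.

(** The ring [R] is a parameter because the fact serves both [F] and [{poly F}]. *)
Lemma pchar_nat_expn_card (R : nzRingType) k :
  [pchar R] =i [pchar F] -> [pchar R].-nat (#|F| ^ k)%N.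
Proof.
move=> eqRF; have [p p_pr pF] := finPcharP F.
have cF : #|F| = (p ^ logn p #|F|)%N := card_pprimeChar pF.
by rewrite (eq_pnat _ eqRF) (eq_pnat _ (pcharf_eq pF)) cF !pnatX pnat_id.
Qed.

Lemma expf_expn_card (a : F) k : a ^+ (#|F| ^ k) = a.
Proof. by elim: k => // k IHk; rewrite expnS exprM expf_card. Qed.

Lemma size_frobX k : (0 < k)%N -> size (frobX k) = (#|F| ^ k).+1.
Proof.
move=> k_gt0; rewrite /frobX size_polyDl ?size_polyXn // size_polyN size_polyX.
by rewrite ltnS expn_card_gt1.
Qed.

Lemma monic_frobX k : (0 < k)%N -> frobX k \is monic.
Proof.
move=> k_gt0; rewrite /frobX monicE lead_coefDl ?lead_coefXn //.
rewrite size_polyN size_polyX size_polyXn.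
by rewrite ltnS expn_card_gt1.
Qed.

Lemma separable_frobX k : (0 < k)%N -> separable_poly (frobX k).
Proof.
move=> k_gt0; rewrite unlock derivB derivX derivXn.
(* As q vanishes in [F], the derivative of [frobX k] is -1. *)
have -> : 'X^((#|F| ^ k).-1) *+ (#|F| ^ k)%N = 0 :> {poly F}.
  rewrite -mulr_natr -[_%:R]polyC_natr natrX.
  suff -> : (#|F|%:R : F) = 0 by rewrite expr0n gtn_eqF // mulr0.
  have [p p_pr pF] := finPcharP F; apply/eqP; rewrite -(dvdn_pcharf pF).
  have := pchar_nat_expn_card 1 (fun=> erefl : _ = _ :> bool).
  rewrite expn1 (eq_pnat _ (pcharf_eq pF)) => /p_natP[[|e] cF].
    by have := card_gt1; rewrite cF.
  by rewrite cF expnS dvdn_mulr.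
by rewrite sub0r -scaleN1r coprimepZr ?oppr_eq0 ?oner_eq0 ?coprimep1.
Qed.

(** The power q^k is additive and fixes constants, so p^(q^k) is p evaluated at X^(q^k), which is
    congruent to X. *)
Lemma frobX_dvd_exp_sub k p : frobX k %| p ^+ (#|F| ^ k) - p.
Proof.
have pn := pchar_nat_expn_card k (pchar_poly F).
elim/poly_ind: p => [|p c IHp].
  by rewrite expr0n expn_eq0 gtn_eqF ?(ltnW card_gt1) // subr0 dvdp0.
rewrite exprDn_pchar // exprMn -polyC_exp expf_expn_card opprD addrACA subrr addr0.
have -> : p ^+ (#|F| ^ k) * 'X^(#|F| ^ k) - p * 'X
  = p ^+ (#|F| ^ k) * frobX k + (p ^+ (#|F| ^ k) - p) * 'X.
  by rewrite /frobX mulrBr mulrBl addrA subrK.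
by apply: dvdp_add; [apply: dvdp_mull; apply: dvdpp | apply: dvdp_mulr].
Qed.

(** Modulo [f] the map p -> p^(q^k) is the identity, hence so is its j-th iterate. *)
Lemma dvd_exp_sub_iter f k j p : f %| frobX k ->
  f %| p ^+ (#|F| ^ (k * j)) - p.
Proof.
move=> fk; elim: j p => [|j IHj] p; first by rewrite muln0 expn0 subrr dvdp0.
rewrite mulnS expnD exprM -(subrK (p ^+ (#|F| ^ k)) (_ ^+ _)) -addrA.
by rewrite dvdp_add ?IHj ?(dvdp_trans fk) ?frobX_dvd_exp_sub.
Qed.

Lemma frobX_dvd k m : (k %| m)%N -> frobX k %| frobX m.
Proof. by move=> /dvdnP[j ->]; rewrite mulnC dvd_exp_sub_iter. Qed.

(** A Euclidean step on exponents: modulo [f], X^(q^m) is congruent to X^(q^(m mod d)). *)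
Lemma dvd_frobX_modn f d m : f %| frobX d -> f %| frobX m -> f %| frobX (m %% d).
Proof.
move=> fd fm; rewrite /frobX.
have := dvd_exp_sub_iter (m %/ d) 'X^(#|F| ^ (m %% d)) fd.
rewrite mulnC -exprM -expnD addnC -divn_eq => f1.
by have := dvdp_sub fm f1; rewrite /frobX opprB addrC subrKA.
Qed.

Lemma in_qpoly_eq0 f p : f \is monic -> (1 < size f)%N ->
  (in_qpoly f p == 0) = (f %| p).
Proof.
move=> fM sf; rewrite -val_eqE /= /mk_monic sf fM /=.
by rewrite -Pdiv.IdomainMonic.modpE.
Qed.

Lemma in_qpoly_polyn f (a : {poly %/ f}) : in_qpoly f (polyn a) = a.
Proof. exact/val_inj/in_qpoly_small/size_mk_monic. Qed.

(** F[t]/(g) is a field with q^(deg g) elements, so that power fixes the class of X. *)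
Lemma irreducible_dvd_frobX g : monic_irreducible_poly g ->
  g %| frobX (size g).-1.
Proof.
move=> gMI; have [[sg _] gM] := gMI.
rewrite -in_qpoly_eq0 // rmorphB rmorphXn /= subr_eq0; apply/eqP.
rewrite -card_qfpoly; exact: (@expf_card {poly %/ g with gMI}).
Qed.

Lemma irreducible_dvd_frobXE g m : monic_irreducible_poly g ->
  (g %| frobX m) = ((size g).-1 %| m)%N.
Proof.
move=> gMI; have [[sg _] gM] := gMI; set d := _.-1.
apply/idP/idP => [gm | dm]; last first.
  exact: dvdp_trans (irreducible_dvd_frobX gMI) (frobX_dvd dm).
have := dvd_frobX_modn (irreducible_dvd_frobX gMI) gm.
rewrite -/d /dvdn; have [//|r_gt0] := posnP; move: (m %% d)%N (@ltn_pmod m d) r_gt0.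
move=> r ltrd r_gt0 gr; have {ltrd} ltrd : (r < d)%N.
  by apply: ltrd; rewrite /d -subn1 subn_gt0.
(* With 0 < r < d, all q^d elements of the field F[t]/(g) would be roots of X^(q^r) - X, which has
   degree only q^r. *)
pose K : finFieldType := {poly %/ g with gMI}.
pose P : {poly K} := 'X^(#|F| ^ r) - 'X.
have sP : size P = (#|F| ^ r).+1.
  rewrite size_polyDl ?size_polyXn // size_polyN size_polyX.
  by rewrite ltnS expn_card_gt1.
have : (size (enum K) < size P)%N.
  apply: max_poly_roots; rewrite ?enum_uniq -?size_poly_eq0 ?sP //.
  apply/allP => a _; rewrite /root !hornerE subr_eq0; apply/eqP.
  pose b : {poly %/ g} := a.
  have /eqP : in_qpoly g (polyn b ^+ (#|F| ^ r) - polyn b) == 0.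
    by rewrite in_qpoly_eq0 // (dvdp_trans gr) ?frobX_dvd_exp_sub.
  by rewrite rmorphB rmorphXn /= in_qpoly_polyn => /eqP; rewrite subr_eq0 => /eqP.
by rewrite -cardE card_qfpoly sP ltnS leq_exp2l ?card_gt1 // -/d leqNgt ltrd.
Qed.

(** * Irreducible factors and the criterion for Carmichael polynomials *)

Lemma exists_monic_irreducible_dvd f : (1 < size f)%N ->
  exists2 g, monic_irreducible_poly g & g %| f.
Proof.
have [k] := ubnP (size f); elim: k f => // k IHk f /ltnSE sfk sf.
have f0 : f != 0 by rewrite -size_poly_gt0 ltnW.
have [/irreducibleP fI | fNI] := boolP (irreducibleb f).
  exists ((lead_coef f)^-1 *: f); last by rewrite dvdpZl ?invr_eq0 ?lead_coef_eq0.
  split; last by rewrite monicE lead_coefZ mulVf ?lead_coef_eq0.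
  have e := eqp_scale f (_ : (lead_coef f)^-1 != 0).
  split; first by rewrite size_scale ?invr_eq0 ?lead_coef_eq0.
  move=> q sq qf; rewrite (eqp_trans (fI q sq _)) //.
    by rewrite (dvdp_trans qf) // (eqp_dvdl _ (e _)) ?invr_eq0 ?lead_coef_eq0.
  by rewrite eqp_sym e ?invr_eq0 ?lead_coef_eq0.
move: fNI; rewrite /irreducibleb sf /= negb_forall => /existsP[q].
rewrite negb_imply -Pdiv.Idomain.dvdpE -ltnNge => /andP[qf sq].
have [||g gMI gq] := IHk (val q) => //.
  by apply: leq_ltn_trans (size_npoly q) _; case: (size f) sf sfk.
by exists g => //; apply: dvdp_trans gq qf.
Qed.

(** An irreducible factor of f / gcd(f, h) would also divide gcd(f, h), so its square would divide
    the separable [f]. *)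
Lemma separable_dvdp f h : separable_poly f ->
  (forall g, monic_irreducible_poly g -> g %| f -> g %| h) -> f %| h.
Proof.
move=> fS fh; have f0 := separable_poly_neq0 fS.
have d0 : gcdp f h != 0 by rewrite gcdp_eq0 negb_and f0.
have Ef := divpK (dvdp_gcdl f h).
have c0 : f %/ gcdp f h != 0 by apply: contraNneq f0 => c0; rewrite -Ef c0 mul0r.
have [|sc] := ltnP 1 (size (f %/ gcdp f h)).
  move=> /exists_monic_irreducible_dvd[g gMI gc].
  have gf : g %| f by rewrite -Ef dvdp_mulr.
  have gd : g %| gcdp f h by rewrite dvdp_gcd gf fh.
  have : g ^+ 2 %| f by rewrite -Ef dvdp_mul.
  by rewrite (separable_nosquare fS) // gtn_eqF //; case: gMI => -[].
have sc1 : size (f %/ gcdp f h) = 1%N.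
  by apply/eqP; rewrite eqn_leq sc size_poly_gt0.
have {sc1}/eqP/size_poly1P[c c_neq0 Ec] := sc1.
by rewrite -Ef Ec mul_polyC dvdpZl // dvdp_gcdr.
Qed.

(** The quotient has q^(deg f) elements, and its power identity holds for every class as soon as it
    holds for the class of X. *)
Lemma carmichael_polyE f : f \is monic -> (1 < size f)%N ->
  carmichael_poly f = ~~ irreducibleb f && (f %| frobX (size f).-1).
Proof.
move=> fM sf; rewrite /carmichael_poly /carmichael_ring.
(* [mk_monic] falls back to a default unless its argument is monic and nonconstant. *)
have hE : mk_monic f = f by rewrite /mk_monic sf fM.
congr (~~ _ && _).
  apply/forallP/irreducibleP => [fF | fI a].
    split=> // q sq qf; have q0 : q != 0.
      by apply: contraTneq qf => ->; rewrite dvd0p -size_poly_gt0 ltnW.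
    have [lt_qf | ] := ltnP (size q) (size f); last first.
      move=> le_fq; rewrite -dvdp_size_eqp // eqn_leq le_fq dvdp_leq //.
      by rewrite -size_poly_gt0 ltnW.
    (* A proper nonconstant divisor has a nonzero class; as a unit, it would be coprime to [f]. *)
    have /implyP/(_ _) := fF (in_qpoly f q).
    rewrite in_qpoly_eq0 // => /(_ _)/unitrP[|b [ba _]].
      by apply: contraL lt_qf => /dvdp_leq; rewrite -leqNgt; apply.
    have := qpoly_intro_unit ba.
    rewrite in_qpoly_small ?hE // => /coprimepP/(_ q qf (dvdpp q)).
    by rewrite -size_poly_eq1 (negPf sq).
  apply/implyP => a0; apply/unitrP; exists (qpoly_inv a).
  have cp : coprimep (mk_monic f) (val a) by apply: (@coprimep_unit _ _ (fI, fM)).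
  split; [exact: qpoly_mulVz | exact: qpoly_mulzV].
rewrite card_monic_qpoly //; apply/forallP/idP => [fX | fX a].
  by rewrite -in_qpoly_eq0 // rmorphB rmorphXn /= subr_eq0 fX.
rewrite -(in_qpoly_polyn a) -subr_eq0 -rmorphXn -rmorphB in_qpoly_eq0 //.
exact: dvdp_trans fX (frobX_dvd_exp_sub _ _).
Qed.

(** Irreducible factors of [f] have degree 1, p or p^2; the last would make [f] itself irreducible.
    The others divide [frobX p], and [f] is separable. *)
Lemma carmichael_dvd_frobX_prime f (p : nat) : prime p ->
  f \is monic -> size f = (p * p).+1 -> carmichael_poly f -> f %| frobX p.
Proof.
move=> p_pr fM sf.
have p0 := prime_gt0 p_pr; have pp0 : (0 < p * p)%N by rewrite muln_gt0 p0.
have sf1 : (1 < size f)%N by rewrite sf.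
rewrite carmichael_polyE // sf /= => /andP[fNI fX].
apply: separable_dvdp (dvdp_separable fX (separable_frobX pp0)) _ => g gMI gf.
have := dvdp_trans gf fX; rewrite !irreducible_dvd_frobXE //.
rewrite mulnn => /(dvdn_pfactor _ _ p_pr)[[|[|[|e]]]] // _ Eg; rewrite Eg ?expn1 //.
case/negP: fNI; apply/irreducibleP; case: gMI => -[sg gI] gM.
have : g %= f by rewrite -dvdp_size_eqp // sf mulnn -Eg prednK // ltnW.
by rewrite eqp_monic // => /eqP <-.
Qed.

End Frobenius.

(** * Products of distinct irreducibles, and the number of irreducibles of given degree *)

Section Counting.
Variable F : finFieldType.
Implicit Types (f g h : {poly F}) (s : seq {poly F}) (n m d : nat).

Definition monic_irreducibleb (p : {poly F}) := (p \is monic) && irreducibleb p.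

Lemma monic_irreducibleP p : monic_irreducibleb p -> monic_irreducible_poly p.
Proof. by move=> /andP[pM /irreducibleP pI]. Qed.

(** Unique factorization in the form used for injectivity: a product of monic irreducibles
    determines which of them occur. *)
Lemma irreducible_dvd_prod g s : monic_irreducibleb g ->
  all monic_irreducibleb s -> (g %| \prod_(p <- s) p) = (g \in s).
Proof.
move=> /monic_irreducibleP[gI gM]; have [sg _] := gI.
elim: s => [_|p s IHs /=/andP[/monic_irreducibleP[pI pM] /IHs{}IHs]].
  by rewrite big_nil in_nil dvdp1 gtn_eqF.
rewrite big_cons inE -IHs; have [gp|ngp] := boolP (g %| p).
  have : g %= p by apply: pI => //; rewrite gtn_eqF.
  by rewrite eqp_monic // => /eqP ->; rewrite eqxx dvdp_mulIl.
rewrite Gauss_dvdpr ?irreducible_poly_coprime //.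
by rewrite (negPf (contraNneq _ ngp)) // => ->.
Qed.

Lemma prod_irreducible_dvdp h s : uniq s -> all monic_irreducibleb s ->
  all (fun p => p %| h) s -> \prod_(p <- s) p %| h.
Proof.
elim: s => [|p s IHs] /=; first by rewrite big_nil dvd1p.
move=> /andP[ps sU] /andP[pI sI] /andP[ph sh].
rewrite big_cons Gauss_dvdp ?ph ?IHs //.
rewrite irreducible_poly_coprime ?irreducible_dvd_prod //.
by case: (monic_irreducibleP pI).
Qed.

Lemma degree_prod_monic (I : Type) (r : seq I) (P : pred I) (E : I -> {poly F}) :
  (forall i, P i -> E i \is monic) ->
  (size (\prod_(i <- r | P i) E i)).-1 = (\sum_(i <- r | P i) (size (E i)).-1)%N.
Proof.
move=> EM; suff [] : (\prod_(i <- r | P i) E i \is monic) /\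
  (size (\prod_(i <- r | P i) E i)).-1 = (\sum_(i <- r | P i) (size (E i)).-1)%N by [].
elim/big_rec2: _ => [|i m f Pi [fM <-]]; first by rewrite monic1 size_poly1.
have Ei := EM i Pi; split; first by rewrite monicMl.
rewrite size_monicM ?monic_neq0 //.
have := monic_neq0 Ei; have := monic_neq0 fM; rewrite -!size_poly_gt0.
by case: (size f) => // a; case: (size (E i)) => // b; rewrite addnS addSn.
Qed.

Lemma monic_prod_irreducible s : all monic_irreducibleb s ->
  \prod_(p <- s) p \is monic.
Proof. by move=> /allP sI; rewrite big_seq rpred_prod // => p /sI/andP[]. Qed.

Lemma carmichael_prod n s : (0 < n)%N -> uniq s -> all monic_irreducibleb s ->
  (\sum_(p <- s) (size p).-1 = n)%N ->
  (forall p, p \in s -> ((size p).-1 < n)%N /\ ((size p).-1 %| n)%N) ->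
  size (\prod_(p <- s) p) = n.+1 /\ carmichael_poly (\prod_(p <- s) p).
Proof.
move=> n_gt0 sU sI sn sd; have fM := monic_prod_irreducible sI.
have sf : size (\prod_(p <- s) p) = n.+1.
  rewrite -[size _]prednK ?size_poly_gt0 ?monic_neq0 //.
  rewrite big_seq degree_prod_monic -?big_seq ?sn //.
  by move=> p /(allP sI)/andP[].
split=> //; rewrite carmichael_polyE ?sf //=; apply/andP; split; last first.
  apply: prod_irreducible_dvdp => //; apply/allP => p ps.
  rewrite irreducible_dvd_frobXE; first by case: (sd p ps).
  exact/monic_irreducibleP/(allP sI).
apply/irreducibleP => -[_ fI].
(* Since n > 0 there is some factor; its degree is below n, so the product is reducible. *)
have /hasP[p ps _] : has xpredT s.
  rewrite has_predT; case: s sn {sU sI sd fM sf fI} => //.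
  by rewrite big_nil => n0; rewrite -n0 in n_gt0.
have pI := allP sI p ps; have [[sp _] _] := monic_irreducibleP pI.
have : p %= \prod_(q <- s) q.
  by apply: fI; [rewrite gtn_eqF | rewrite irreducible_dvd_prod].
have [pn _] := sd p ps.
by move=> /eqp_size sE; rewrite sE sf ltnn in pn.
Qed.

(** Sending a set of irreducibles to its product is injective by unique factorization, with values
    in Carmichael polynomials. *)
Lemma leq_card_Cq n (S : {set {set {poly_(n.+1) F}}}) : (0 < n)%N ->
  (forall A, A \in S ->
    (\sum_(p in A) (size (polyn p)).-1 = n)%N /\
    (forall p, p \in A -> [&& monic_irreducibleb (polyn p),
       ((size (polyn p)).-1 < n)%N & ((size (polyn p)).-1 %| n)%N])) ->
  (#|S| <= Cq F n)%N.
Proof.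
move=> n_gt0 SP; pose s (A : {set {poly_(n.+1) F}}) := map (@polyn F _) (enum A).
pose f A := \prod_(p <- s A) p.
have mem_s A p : (polyn p \in s A) = (p \in A).
  by rewrite (mem_map val_inj) mem_enum.
have sI A : A \in S -> all monic_irreducibleb (s A).
  move=> AS; apply/allP => _ /mapP[p pA ->].
  by rewrite mem_enum in pA; case/and3P: ((SP A AS).2 p pA).
have sC A : A \in S -> size (f A) = n.+1 /\ carmichael_poly (f A).
  move=> AS; apply: carmichael_prod (sI A AS) _ _ => //.
  - by rewrite (map_inj_uniq val_inj) enum_uniq.
  - by rewrite big_map big_enum (SP A AS).1.
  move=> _ /mapP[p pA ->]; rewrite mem_enum in pA.
  by case/and3P: ((SP A AS).2 p pA).
have fK A : A \in S -> polyn (npolyp n.+1 (f A)) = f A.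
  by move=> AS; rewrite npolypK ?(sC A AS).1.
have f_inj : {in S &, injective (fun A => npolyp n.+1 (f A))}.
  move=> A B AS BS /(congr1 (@polyn F _)); rewrite !fK // => fAB.
  apply/setP => p; apply/idP/idP => pX.
    have pI : monic_irreducibleb (polyn p) by case/and3P: ((SP A AS).2 p pX).
    by rewrite -mem_s -irreducible_dvd_prod ?sI // -/(f B) -fAB
      irreducible_dvd_prod ?sI ?mem_s.
  have pI : monic_irreducibleb (polyn p) by case/and3P: ((SP B BS).2 p pX).
  by rewrite -mem_s -irreducible_dvd_prod ?sI // -/(f A) fAB
    irreducible_dvd_prod ?sI ?mem_s.
rewrite -(card_in_imset f_inj) subset_leq_card //.
apply/subsetP => _ /imsetP[A AS ->]; rewrite inE !fK //.
by have [-> ->] := sC A AS; rewrite eqxx andbT monic_prod_irreducible ?sI.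
Qed.

(* The ambient finite type only contains degrees up to n: empty if d > n. *)
Definition irreducibles n d : {set {poly_(n.+1) F}} :=
  [set p | monic_irreducibleb (polyn p) && (size (polyn p) == d.+1)].

Lemma degree_irreducibles n d (p : {poly_(n.+1) F}) :
  p \in irreducibles n d -> (size (polyn p)).-1 = d.
Proof. by rewrite inE => /andP[_ /eqP ->]. Qed.

Lemma sum_degree_irreducibles n d (A : {set {poly_(n.+1) F}}) :
  A \subset irreducibles n d ->
  (\sum_(p in A) (size (polyn p)).-1 = #|A| * d)%N.
Proof.
move=> /subsetP Ad; rewrite -sum_nat_const.
by apply: eq_bigr => p /Ad/degree_irreducibles.
Qed.

Lemma prod_irreducibles_monic n d :
  \prod_(p in irreducibles n d) polyn p \is monic.
Proof. by rewrite rpred_prod // => p; rewrite inE => /andP[/andP[]]. Qed.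

Lemma degree_prod_irreducibles n d :
  (size (\prod_(p in irreducibles n d) polyn p)).-1 = (#|irreducibles n d| * d)%N.
Proof.
rewrite degree_prod_monic ?(sum_degree_irreducibles (subxx _)) // => p.
by rewrite inE => /andP[/andP[]].
Qed.

(** The product of these irreducibles divides X^(q^d) - X; degrees are compared. *)
Lemma card_irreducibles_leq n d : (0 < d)%N ->
  (#|irreducibles n d| * d <= #|F| ^ d)%N.
Proof.
move=> d_gt0; rewrite -degree_prod_irreducibles -ltnS -(size_frobX F d_gt0).
apply: leq_ltn_trans (_ : (size (frobX F d)).-1 < _)%N; last first.
  by rewrite prednK // size_frobX.
rewrite -!subn1 leq_sub2r // dvdp_leq ?monic_neq0 ?monic_frobX //.
rewrite -big_enum -(big_map (@polyn F _) xpredT id).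
apply: prod_irreducible_dvdp; first by rewrite (map_inj_uniq val_inj) enum_uniq.
  by apply/allP => _ /mapP[p + ->]; rewrite mem_enum inE => /andP[].
apply/allP => _ /mapP[p + ->]; rewrite mem_enum inE => /andP[pI /eqP sp].
by rewrite irreducible_dvd_frobXE ?sp //; apply: monic_irreducibleP.
Qed.

(** X^(q^m) - X is separable and its irreducible factors have degree dividing m, so it divides the
    product of all such irreducibles. The bound m <= n ensures that [irreducibles n] contains
    them. *)
Lemma expn_card_leq_sum n m : (0 < m <= n)%N ->
  (#|F| ^ m <= \sum_(d < m.+1 | d %| m) #|irreducibles n d| * d)%N.
Proof.
move=> /andP[m_gt0 le_mn].
pose f := \prod_(d < m.+1 | (d %| m)%N) \prod_(p in irreducibles n d) polyn p.
have fM : f \is monic by rewrite rpred_prod // => d _; apply: prod_irreducibles_monic.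
have -> : (\sum_(d < m.+1 | d %| m) #|irreducibles n d| * d = (size f).-1)%N.
  rewrite degree_prod_monic => [|d _]; last exact: prod_irreducibles_monic.
  by apply: eq_bigr => d _; rewrite degree_prod_irreducibles.
rewrite -[(_ ^ _)%N]/((#|F| ^ m).+1.-1) -size_frobX // -!subn1 leq_sub2r //.
rewrite dvdp_leq ?monic_neq0 //.
apply: separable_dvdp (separable_frobX _ m_gt0) _ => g gMI.
rewrite irreducible_dvd_frobXE // => gm; have [[sg gI] gM] := gMI.
have sgm : ((size g).-1 < m.+1)%N by rewrite ltnS dvdn_leq.
have sgn : (size g <= n.+1)%N by rewrite -(prednK (ltnW sg)) ltnS (leq_trans _ le_mn).
rewrite /f (bigD1 (Ordinal sgm)) //= dvdp_mulr //.
rewrite (bigD1 (npolyp n.+1 g)) /= ?npolypK ?dvdp_mulIl //.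
rewrite inE /monic_irreducibleb npolypK // gM prednK ?eqxx ?andbT ?(ltnW sg) //.
exact/irreducibleP.
Qed.

Lemma expn_card_leq n m : (0 < m <= n)%N ->
  (#|F| ^ m <= #|irreducibles n m| * m + \sum_(d < m | d %| m) #|F| ^ d)%N.
Proof.
move=> mn; have /andP[m_gt0 _] := mn.
apply: leq_trans (expn_card_leq_sum mn) _.
rewrite big_mkcond big_ord_recr /= dvdnn addnC leq_add2l -big_mkcond /=.
apply: leq_sum => d /dvdn_gt0 dm; rewrite card_irreducibles_leq ?dm //.
Qed.

End Counting.

(** * Inequalities for binomial coefficients and power sums *)

Local Open Scope nat_scope.

(** Each factor (N - i) / (l - i) of the binomial coefficient is at least N / l; denominators are
    cleared. *)
Lemma leq_expn_bin N l : l <= N -> N ^ l <= 'C(N, l) * l ^ l.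
Proof.
move=> le_lN; rewrite -(leq_pmul2r (fact_gt0 l)) mulnAC bin_ffact.
rewrite -ffactnn !ffact_prod -[l in N ^ l]card_ord -[l in l ^ l]card_ord.
rewrite -!prod_nat_const -!big_split /= leq_prod // => i _.
by rewrite card_ord mulnBr mulnBl leq_sub2l // mulnC leq_mul2r le_lN orbT.
Qed.

Lemma sum_expn_lt q N (P : pred nat) : 1 < q -> \sum_(d < N | P d) q ^ d < q ^ N.
Proof.
move=> q_gt1; elim: N => [|N IHN]; first by rewrite big_ord0.
rewrite big_mkcond big_ord_recr /= -big_mkcond /=.
apply: leq_trans (_ : q ^ N + q ^ N <= _).
  by rewrite -addSn leq_add //; case: ifP.
by rewrite addnn -mul2n expnS leq_mul2r q_gt1 orbT.
Qed.

Lemma double_sum_divisors_expn q m : 1 < q -> 1 < m ->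
  2 * \sum_(d < m | d %| m) q ^ d <= q ^ m.
Proof.
move=> q_gt1; case: m => [|[|[|m]]] // _.
  rewrite big_mkcond !big_ord_recl big_ord0 /= addn0 expn1 expnS expn1.
  by rewrite leq_mul2r q_gt1 orbT.
(* Proper divisors are at most M/2, so their sum is below q^(M/2 + 1). The extra factor 2 costs one
   more exponent, which needs M >= 3; hence the separate case 2. *)
set M := m.+3; have le_M : M./2.+2 <= M by rewrite /M; lia.
have -> : \sum_(d < M | d %| M) q ^ d
          = \sum_(d < M | (d %| M) && (d < M./2.+1)) q ^ d.
  apply: eq_bigl => d; apply: esym; apply: andb_idr => /dvdnP[k].
  by move: (nat_of_ord d) (ltn_ord d); case: k => [|[|k]]; clearbody M; nia.
rewrite (big_ord_narrow_cond (ltnW le_M)) /=.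
apply: leq_trans (leq_pexp2l (ltnW q_gt1) le_M); rewrite expnS.
by rewrite leq_mul // ltnW // (sum_expn_lt _ (fun d => d %| M)).
Qed.

(** * Lower bounds from products of l irreducibles of degree m *)

Section Bounds.
Variable F : finFieldType.
Variables n l m : nat.
Hypotheses (n_lm : n = l * m) (l_gt1 : 1 < l) (m_gt1 : 1 < m).

Let m_gt0 : 0 < m. Proof. exact: ltnW. Qed.
Let n_gt0 : 0 < n. Proof. by rewrite n_lm muln_gt0 m_gt0 ltnW. Qed.
Let lt_mn : m < n. Proof. by rewrite n_lm -[X in X < _]mul1n ltn_pmul2r. Qed.
Let m_dvd_n : m %| n. Proof. by rewrite n_lm dvdn_mull. Qed.
Let N := #|irreducibles F n m|.

Let products :=
  [set A : {set {poly_(n.+1) F}} | A \subset irreducibles F n m & #|A| == l].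

Let productsP (A : {set {poly_(n.+1) F}}) : A \in products ->
  \sum_(p in A) (size (polyn p)).-1 = n /\
  (forall p, p \in A -> [&& monic_irreducibleb (polyn p),
     (size (polyn p)).-1 < n & (size (polyn p)).-1 %| n]).
Proof.
rewrite inE => /andP[Am /eqP cA].
split=> [|p /(subsetP Am) pm]; first by rewrite (sum_degree_irreducibles Am) cA.
rewrite (degree_irreducibles pm) lt_mn m_dvd_n !andbT.
by move: pm; rewrite inE => /andP[].
Qed.

Lemma bin_leq_Cq : 'C(N, l) <= Cq F n.
Proof. by rewrite -cards_draws; apply: leq_card_Cq productsP. Qed.

(** For degree 6, where the binomial coefficient alone may only give 1: a factor set of another type
    contributes one more product. *)
Lemma bin_lt_Cq (A : {set {poly_(n.+1) F}}) :
  \sum_(p in A) (size (polyn p)).-1 = n ->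
  (forall p, p \in A -> [&& monic_irreducibleb (polyn p),
     (size (polyn p)).-1 < n & (size (polyn p)).-1 %| n]) ->
  ~~ (A \subset irreducibles F n m) -> 'C(N, l) < Cq F n.
Proof.
move=> sA AP Am; rewrite -cards_draws -/products.
have -> : #|products|.+1 = #|A |: products|.
  by rewrite cardsU1 inE (negPf Am).
apply: leq_card_Cq => // B /setU1P[-> | /productsP] //.
Qed.

(** Proper divisors of m account for at most half of q^m. *)
Lemma expn_card_leq_double : #|F| ^ m <= 2 * m * N.
Proof.
have := @expn_card_leq F n m; rewrite m_gt0 ltnW // => /(_ isT).
have := double_sum_divisors_expn (card_gt1 F) m_gt1; rewrite -/N; lia.
Qed.

(** The chain is q^n = (q^m)^l <= (2 m N)^l <= (2 m)^l binomial(N, l) l^l, where l m = n. *)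
Lemma expn_card_leq_Cq : l <= N -> #|F| ^ n <= Cq F n * (2 * n) ^ l.
Proof.
move=> le_lN; have -> : #|F| ^ n = (#|F| ^ m) ^ l by rewrite -expnM mulnC -n_lm.
have l_gt0 := ltnW l_gt1.
apply: leq_trans (_ : (2 * m * N) ^ l <= _).
  by rewrite leq_exp2r ?expn_card_leq_double.
rewrite mulnC expnMn; apply: leq_trans (leq_mul (leq_expn_bin le_lN) (leqnn _)) _.
apply: leq_trans (_ : 'C(N, l) * (2 * n) ^ l <= _); last first.
  by rewrite leq_mul2r bin_leq_Cq orbT.
by rewrite -mulnA -expnMn n_lm mulnCA.
Qed.

End Bounds.

(** * Degrees that are squares of primes *)

Lemma Cq_prime_sqr_eq0 (F : finFieldType) p :
  prime p -> #|F| ^ p < p * p -> Cq F (p * p) = 0.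
Proof.
move=> p_pr lt_qp; apply/eqP; rewrite cards_eq0; apply/eqP/setP => f.
rewrite inE [RHS]inE; apply/negP => /and3P[fM /eqP sf fC].
have p_gt0 := prime_gt0 p_pr.
have := dvdp_leq (monic_neq0 (monic_frobX F p_gt0))
  (carmichael_dvd_frobX_prime p_pr fM sf fC).
by rewrite sf size_frobX // ltnS leqNgt lt_qp.
Qed.

(** A Carmichael polynomial here divides the monic [frobX p] of the same degree, so equals it;
    conversely [frobX p] is reducible because X divides it. *)
Lemma Cq_prime_sqr_eq1 (F : finFieldType) p :
  prime p -> #|F| ^ p = p * p -> Cq F (p * p) = 1.
Proof.
move=> p_pr q_p; have p_gt0 := prime_gt0 p_pr; have p_gt1 := prime_gt1 p_pr.
have sX := size_frobX F p_gt0; have XM := monic_frobX F p_gt0.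
have pX : polyn (npolyp (p * p).+1 (frobX F p)) = frobX F p.
  by rewrite npolypK // sX q_p.
apply/eqP/cards1P; exists (npolyp (p * p).+1 (frobX F p)).
apply/setP => f; rewrite !inE; apply/and3P/eqP => [[fM /eqP sf fC] | ->].
  apply: val_inj; rewrite /= pX; apply/eqP; rewrite -eqp_monic //.
  by rewrite -dvdp_size_eqp ?carmichael_dvd_frobX_prime // sf sX q_p.
rewrite pX sX q_p XM eqxx; split=> //.
rewrite carmichael_polyE ?sX ?q_p ?ltnS ?muln_gt0 ?p_gt0 //=.
rewrite frobX_dvd ?dvdn_mulr // andbT; apply/irreducibleP => -[_ fI].
have /fI : (size ('X : {poly F}) != 1)%N by rewrite size_polyX.
have XX : ('X %| frobX F p)%R.
  rewrite /frobX dvdp_sub // -[#|F| ^ p]prednK ?expn_gt0 ?(ltnW (card_gt1 F)) //.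
  by rewrite GRing.exprS dvdp_mulIl.
move=> /(_ XX)/eqp_size; rewrite size_polyX sX q_p; nia.
Qed.

(** * Small fields and small degrees *)

Lemma double_square_lt_expn2 m : 6 < m -> 2 * m * m < 2 ^ m.
Proof.
move=> /subnK <-; elim: (m - 7) => [|k IHk] //; rewrite addSn expnS; nia.
Qed.

Lemma double_square_lt_expn3 m : 1 < m -> 2 * m * m < 3 ^ m.
Proof.
move=> /subnK <-; elim: (m - 2) => [|k IHk] //; rewrite addSn expnS; nia.
Qed.

(** If N <= l, then l <= m gives q^m <= 2 m N <= 2 m^2, which forces q = 2 and m <= 6. *)
Lemma card_irreducibles_gt (F : finFieldType) n l m :
  n = l * m -> 1 < l -> 1 < m -> l <= pdiv m ->
  l < #|irreducibles F n m| \/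
  #|F| = 2 /\ (l, m) \in [:: (2, 2); (2, 3); (3, 3)].
Proof.
move=> n_lm l_gt1 m_gt1 lm; set N := #|_|.
have [|le_Nl] := ltnP l N; [by left | right].
have le_lm : l <= m := leq_trans lm (dvdn_leq (ltnW m_gt1) (pdiv_dvd m)).
have qm : #|F| ^ m <= 2 * m * m.
  apply: leq_trans (expn_card_leq_double F n_lm l_gt1 m_gt1) _.
  by rewrite leq_mul // (leq_trans le_Nl).
have q_gt1 := card_gt1 F.
have q2 : #|F| = 2.
  apply/eqP; rewrite eqn_leq q_gt1 andbT leqNgt; apply/negP => q3.
  have := leq_ltn_trans qm (double_square_lt_expn3 m_gt1).
  by rewrite ltn_exp2r ?(ltnW m_gt1) // ltnNge q3.
split=> //; rewrite q2 in qm.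
have m_le6 : m <= 6.
  by rewrite leqNgt; apply/negP => /double_square_lt_expn2; rewrite ltnNge qm.
(* With the divisor sums evaluated exactly, N is at least 1, 2, 3, 6, 9 for m = 2, ..., 6. For m =
   4, 5, 6 this exceeds the least prime factor of m, hence l. *)
have := @expn_card_leq F n m; rewrite n_lm leq_pmull ?(ltnW l_gt1) // ltnW //.
move=> /(_ isT); rewrite -n_lm -/N q2 big_mkcond.
case: m m_gt1 lm le_lm m_le6 {qm n_lm} @N le_Nl
  => [|[|[|[|[|[|[|]]]]]]] //= _ lm lm' _ le_Nl.
all: rewrite !big_ord_recl big_ord0 /= /bump /= ?expnS ?expn0.
all: case: l l_gt1 lm lm' le_Nl => [|[|[|[|[|[|]]]]]] //= _ _ _ le_Nl.
all: lia.
Qed.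

(** The first conclusion is l <= N for l = 2 and m = 3, as required by the quantitative bound. *)
Lemma Cq_card2_degree6 (F : finFieldType) : #|F| = 2 ->
  1 < #|irreducibles F 6 3| /\ 1 < Cq F 6.
Proof.
move=> q2.
have N1 : 0 < #|irreducibles F 6 1|.
  have := @expn_card_leq F 6 1 isT.
  by rewrite q2 big_mkcond !big_ord_recl big_ord0 /= ?/bump /= ?expnS ?expn0; lia.
have N2 : 0 < #|irreducibles F 6 2|.
  have := @expn_card_leq F 6 2 isT.
  by rewrite q2 big_mkcond !big_ord_recl big_ord0 /= ?/bump /= ?expnS ?expn0; lia.
have N3 : 1 < #|irreducibles F 6 3|.
  have := @expn_card_leq F 6 3 isT.
  by rewrite q2 big_mkcond !big_ord_recl big_ord0 /= ?/bump /= ?expnS ?expn0; lia.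
split=> //; apply: leq_ltn_trans (_ : 'C(#|irreducibles F 6 3|, 2) < _).
  by rewrite bin_gt0.
have /card_gt0P[x1 x1P] := N1; have /card_gt0P[x2 x2P] := N2.
have /card_gt0P[x3 x3P] := ltnW N3.
have d1 := degree_irreducibles x1P; have d2 := degree_irreducibles x2P.
have d3 := degree_irreducibles x3P.
have x12 : x1 != x2 by apply: contraTneq isT => x12; move: d2; rewrite -x12 d1.
have x13 : x1 != x3 by apply: contraTneq isT => x13; move: d3; rewrite -x13 d1.
have x23 : x2 != x3 by apply: contraTneq isT => x23; move: d3; rewrite -x23 d2.
(* Irreducibles of degrees 1, 2 and 3 have total degree 6 and are not all cubic. *)
apply: (@bin_lt_Cq F 6 2 3 _ _ _ [set x1; x2; x3]) => //.
- rewrite setUC big_setU1 ?inE ?(eq_sym x3) ?negb_or ?x13 ?x23 //.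
  by rewrite big_setU1 ?inE // big_set1 /= d1 d2 d3.
- move=> p; rewrite !inE => /orP[/orP[]|] /eqP ->.
  + by move: x1P; rewrite d1 inE => /andP[->].
  + by move: x2P; rewrite d2 inE => /andP[->].
  by move: x3P; rewrite d3 inE => /andP[->].
apply/subsetPn; exists x1; first by rewrite !inE eqxx.
by apply/negP => /degree_irreducibles; rewrite d1.
Qed.

(** * Separation of the exceptional pairs from the general case *)

Theorem theorem4p5 (F : finFieldType) (n : nat) :
  (1 < n)%N -> ~~ prime n ->
  let q := #|F| in
  let l := pdiv n in
  (Cq F n = 0%N <-> (q, n) = (2%N, 9%N)) /\
  ((q, n) <> (2%N, 9%N) ->
     (Cq F n = 1%N <-> (q, n) = (2%N, 4%N)) /\
     (q ^ n <= Cq F n * (2 * n) ^ l)%N).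
Proof.
move=> n_gt1 n_npr q l.
have l_pr : prime l := pdiv_prime n_gt1; have l_gt1 := prime_gt1 l_pr.
have n_lm : n = l * (n %/ l) by rewrite mulnC divnK ?pdiv_dvd.
set m := n %/ l in n_lm.
have m_gt1 : 1 < m.
  case: m n_lm => [|[|m]] // nE; first by rewrite nE muln0 in n_gt1.
  by rewrite nE muln1 l_pr in n_npr.
have lm : l <= pdiv m.
  rewrite pdiv_min_dvd ?prime_gt1 ?pdiv_prime //.
  by rewrite (dvdn_trans (pdiv_dvd m)) // n_lm dvdn_mull.
suff : [\/ 1 < Cq F n /\ l <= #|irreducibles F n m| /\
            (q, n) != (2, 4) /\ (q, n) != (2, 9),
          (q, n) = (2, 4) | (q, n) = (2, 9)].
  case=> [[C1 [lN [/eqP n4 /eqP n9]]] | qn | qn].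
  - split; first by split=> // C0; rewrite C0 in C1.
    move=> _; split; first by split=> // C0; rewrite C0 in C1.
    exact: expn_card_leq_Cq n_lm l_gt1 m_gt1 lN.
  - have [q2 n4] := qn; rewrite /l n4.
    (* Here 2^2 = 2 * 2, and the remaining inequality is 16 <= 8^2. *)
    have C1 : Cq F 4 = 1 by apply: (@Cq_prime_sqr_eq1 F 2); rewrite // -/q q2.
    by rewrite C1 q2.
  have [q2 n9] := qn; rewrite qn n9; split=> //.
  (* Here 2^3 < 3 * 3. *)
  have C0 : Cq F 9 = 0 by apply: (@Cq_prime_sqr_eq0 F 3); rewrite // -/q q2.
  by rewrite C0.
have [/eqP n4|n4] := boolP ((q, n) == (2, 4)); first exact: Or32.
have [/eqP n9|n9] := boolP ((q, n) == (2, 9)); first exact: Or33.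
apply: Or31; have [lN | [q2]] := card_irreducibles_gt F n_lm l_gt1 m_gt1 lm.
  split; last by split; first exact: ltnW.
  (* From N^l <= C_q(n) l^l and l^l < N^l it follows that C_q(n) > 1. *)
  have := leq_trans (leq_expn_bin (ltnW lN))
    (leq_mul (bin_leq_Cq F n_lm l_gt1 m_gt1) (leqnn _)).
  have : l ^ l < #|irreducibles F n m| ^ l by rewrite ltn_exp2r // ltnW.
  case: (Cq F n) => [|[|c]] //; rewrite ?mul0n ?mul1n; lia.
move: n4 n9; rewrite !inE !xpair_eqE n_lm /q q2 => n4 n9.
(* The pairs (2, 2) and (3, 3) give the excluded n = 4 and 9; only n = 6 is left. *)
move=> /or3P[] /andP[/eqP lE /eqP mE]; rewrite lE mE // in n4 n9 *.
by have [N1 C1] := Cq_card2_degree6 q2.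
Qed.
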